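(* Let $p\in\mathbb{Z}^n$ have positive components and $r\in\mathbb{Z}^n$, with $p$ and $r$ not parallel and $r_1/p_1\le\dots\le r_n/p_n$; put $q_i=r_i/p_i$ and $$f(M,\delta)=\left\lceil\frac{M+q_1-\delta}{q_n-q_1}\right\rceil-1 .$$ Assume that $M$ is an integer with $f(M,1)\ge0$ and that $a=pM+r$ is a vector with positive integral components. Then $$f(M,1)(M+q_n)<\operatorname{Frob}_p(a)<(f(M,0)+1)(M+q_1).$$
   Context: $px$, $ax$ denote inner products. For a positive integer $\beta$ consider the problem (KP-EQ): $ax=\beta$, $x\ge0$, $x\in\mathbb{Z}^n$. Its LP relaxation drops $x\in\mathbb{Z}^n$. The infeasibility of (KP-EQ) is proven by branching on $px$ if $px$ is nonintegral for all $x$ in its LP relaxation. The $p$-branching Frobenius number $\operatorname{Frob}_p(a)$ is the largest integer right-hand side $\beta$ for which the infeasibility of (KP-EQ) is proven by branching on $px$ (defined when $f(M,1)\ge0$). *)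

(* Defs.v *)
From mathcomp Require Import all_boot all_order all_algebra.
From mathcomp Require Import reals.
Import Order.TTheory GRing.Theory Num.Theory.

Set Implicit Arguments.
Unset Strict Implicit.
Unset Printing Implicit Defensive.

Local Open Scope ring_scope.

Definition inner (R : realType) (n : nat) (u : 'rV[int]_n) (x : 'rV[R]_n) : R :=
  \sum_(i < n) (u 0 i)%:~R * x 0 i.

(* Linear dependence; in particular the zero vector is parallel to every
   vector. For integer vectors, integer multipliers are as good as real ones. *)
Definition parallel (n : nat) (u v : 'rV[int]_n) : Prop :=
  exists s t : int, (s, t) != (0, 0) /\ s *: u = t *: v.

Definition LP_relaxation (R : realType) (n : nat) (a : 'rV[int]_n) (beta : int)
    (x : 'rV[R]_n) : Prop :=
  inner a x = beta%:~R /\ forall i, 0 <= x 0 i.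

(* Infeasibility of  a x = beta, x >= 0, x integral  is proven by branching
   on the value of p x. *)
Definition proven_by_branching (R : realType) (n : nat) (p a : 'rV[int]_n)
    (beta : int) : Prop :=
  forall x : 'rV[R]_n, LP_relaxation a beta x -> inner p x \isn't a Num.int.

(* Frob_p(a) = F, as a relation because the maximum need not exist for
   arbitrary p and a; right-hand sides are positive integers. *)
Definition is_branching_Frobenius (R : realType) (n : nat) (p a : 'rV[int]_n)
    (F : int) : Prop :=
  [/\ 0 < F, proven_by_branching R p a F &
      forall beta : int, 0 < beta -> proven_by_branching R p a beta ->
        beta <= F].

Definition comp_ratio (R : realType) (n : nat) (p r : 'rV[int]_n) (i : 'I_n) : R :=
  (r 0 i)%:~R / (p 0 i)%:~R.

Definition frob_f (R : realType) (n : nat) (p r : 'rV[int]_n.+1) (M : int)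
    (delta : R) : int :=
  let q := comp_ratio R p r in
  Num.ceil ((M%:~R + q ord0 - delta) / (q ord_max - q ord0)) - 1.

(* Main.v *)
Require Import Defs.
From mathcomp Require Import all_boot all_order all_algebra.
From mathcomp Require Import reals boolp.
From mathcomp Require Import ring lra.
Import Order.TTheory GRing.Theory Num.Theory.

Set Implicit Arguments.
Unset Strict Implicit.
Unset Printing Implicit Defensive.

Local Open Scope ring_scope.

(** Write [c_i = a_i / p_i = M + q_i], and let [lo] and [hi] be the extreme
    ratios [c_1] and [c_n]; since [p] and [r] are not parallel, [lo < hi].
    Over the simplex [a x = beta, x >= 0] the linear form [p x] takes exactly
    the values of the interval [[beta / hi, beta / lo]]: the two ends are the
    vertices on the axes [n] and [1], and the segment between these vertices
    gives everything in between.  So branching on [p x] fails for [beta] iff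
    some integer [k] satisfies [k * lo <= beta <= k * hi]
    ([proven_by_branchingP]), and the right-hand sides where it succeeds are
    the integers that fall in a gap between two consecutive intervals
    [[k * lo, k * hi]] and [[(k + 1) * lo, (k + 1) * hi]].

    The gap after the [k]-th interval has length [lo - k * (hi - lo)], which
    decreases with [k].  The integer [f(M,1)] is the last [k] for which this
    length exceeds 1, so this gap contains an integer, which gives the lower
    bound ([proven_in_gap]).  The integer [f(M,0) + 1] is the first [k] from
    which on the gaps are empty, so that everything from [(f(M,0) + 1) * lo]
    on is covered ([not_proven_above]); this gives the upper bound and, with
    the lower bound, the existence of the maximum. *)

(** * The values of p x on the LP relaxation *)

Section BranchingRange.

Variables (R : realType) (n : nat) (p a : 'rV[int]_n).
Hypothesis p_gt0 : forall i, 0 < p 0 i.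

Let pR_gt0 i : 0 < (p 0 i)%:~R :> R.
Proof. by rewrite ltr0z. Qed.

Lemma comp_ratioK i : comp_ratio R p a i * (p 0 i)%:~R = (a 0 i)%:~R.
Proof. by rewrite divfK // gt_eqF. Qed.

Lemma inner_le_ratio (c : R) (x : 'rV[R]_n) :
    (forall i, comp_ratio R p a i <= c) -> (forall i, 0 <= x 0 i) ->
  inner a x <= c * inner p x.
Proof.
move=> c_ub x_ge0; rewrite /inner mulr_sumr; apply: ler_sum => i _.
by rewrite -comp_ratioK mulrA ler_wpM2r // ler_wpM2r // ltW.
Qed.

Lemma inner_ge_ratio (c : R) (x : 'rV[R]_n) :
    (forall i, c <= comp_ratio R p a i) -> (forall i, 0 <= x 0 i) ->
  c * inner p x <= inner a x.
Proof.
move=> c_lb x_ge0; rewrite /inner mulr_sumr; apply: ler_sum => i _.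
by rewrite -comp_ratioK mulrA ler_wpM2r // ler_wpM2r // ltW.
Qed.

(** On the plane of the axes [i] and [j], the change of variables
    [y = p x] turns the constraints into [y_i + y_j = k] and
    [c_i y_i + c_j y_j = b], whose solution is nonnegative exactly when [b]
    lies between [k c_i] and [k c_j]. *)
Lemma two_axes_point (i j : 'I_n) (k b : R) :
    comp_ratio R p a i < comp_ratio R p a j ->
    k * comp_ratio R p a i <= b <= k * comp_ratio R p a j ->
  exists x : 'rV[R]_n,
    [/\ forall l, 0 <= x 0 l, inner a x = b & inner p x = k].
Proof.
set ci := comp_ratio R p a i; set cj := comp_ratio R p a j.
move=> lt_c /andP[kib bkj].
have neq_ij : i != j by apply: contraTneq lt_c => ij; rewrite /ci ij ltxx.
have d_gt0 : 0 < cj - ci by rewrite subr_gt0.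
have d_neq0 : cj - ci != 0 by rewrite gt_eqF.
pose yi := (k * cj - b) / (cj - ci).
pose yj := (b - k * ci) / (cj - ci).
pose x : 'rV[R]_n := \row_l ((if l == i then yi else if l == j then yj else 0)
                             / (p 0 l)%:~R).
have innerE (u : 'rV[int]_n) : inner u x =
    comp_ratio R p u i * yi + comp_ratio R p u j * yj.
  rewrite /inner (bigD1 i) //= (bigD1 j) 1?eq_sym //= big1 ?addr0.
    rewrite !mxE !eqxx eq_sym (negPf neq_ij) /comp_ratio.
    by congr (_ + _); rewrite mulrA mulrAC.
  by move=> l /andP[/negPf li /negPf lj]; rewrite !mxE li lj mul0r mulr0.
exists x; split=> [l||].
- rewrite mxE divr_ge0 ?(ltW (pR_gt0 l)) //.
  by case: ifP => _; [|case: ifP => _ //]; rewrite divr_ge0 ?subr_ge0 // ltW.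
- by rewrite innerE -/ci -/cj /yi /yj; field.
- rewrite innerE /comp_ratio !divff ?gt_eqF // !mul1r /yi /yj; field.
  exact: d_neq0.
Qed.

Lemma proven_by_branchingP (i j : 'I_n) (beta : int) :
    (forall l, comp_ratio R p a i <= comp_ratio R p a l) ->
    (forall l, comp_ratio R p a l <= comp_ratio R p a j) ->
    comp_ratio R p a i < comp_ratio R p a j ->
  proven_by_branching R p a beta <->
  forall k : int, ~~ (k%:~R * comp_ratio R p a i <= beta%:~R
                        <= k%:~R * comp_ratio R p a j).
Proof.
move=> ci_min cj_max lt_c; split=> [proven k | gap x [ax x_ge0]].
  apply/negP => /(two_axes_point lt_c) [x [x_ge0 ax px]].
  by have := proven x (conj ax x_ge0); rewrite px rpred_int.
apply/negP => /intrP[k px]; case/negP: (gap k).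
rewrite -ax -px ![_ * comp_ratio _ _ _ _]mulrC.
by rewrite inner_ge_ratio ?inner_le_ratio.
Qed.

End BranchingRange.

(** * Gaps between consecutive intervals *)

Section Gaps.

Variables (R : realType) (n : nat) (p a : 'rV[int]_n) (i j : 'I_n).
Hypothesis p_gt0 : forall l, 0 < p 0 l.
Let lo := comp_ratio R p a i.
Let hi := comp_ratio R p a j.
Hypothesis lo_min : forall l, lo <= comp_ratio R p a l.
Hypothesis hi_max : forall l, comp_ratio R p a l <= hi.
Hypothesis lo_gt0 : 0 < lo.
Hypothesis lt_lo_hi : lo < hi.

Lemma proven_in_gap (k beta : int) :
    k%:~R * hi < beta%:~R -> beta%:~R < (k + 1)%:~R * lo ->
  proven_by_branching R p a beta.
Proof.
move=> k_lt lt_k1; apply/(proven_by_branchingP p_gt0 _ lo_min hi_max lt_lo_hi).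
move=> l; apply/negP => /andP[l_le le_l].
have hi_gt0 := lt_trans lo_gt0 lt_lo_hi.
have := lt_le_trans k_lt le_l; rewrite ltr_pM2r // ltr_int => k_lt_l.
have := le_lt_trans l_le lt_k1; rewrite ltr_pM2r // ltr_int ltzD1.
by rewrite leNgt k_lt_l.
Qed.

(** Once [lo <= m * (hi - lo)], each interval [[k * lo, k * hi]] with
    [m <= k] reaches the next one, so the one with [k = floor (beta / lo)]
    contains [beta]. *)
Lemma not_proven_above (m beta : int) :
    lo <= m%:~R * (hi - lo) -> m%:~R * lo <= beta%:~R ->
  ~ proven_by_branching R p a beta.
Proof.
move=> no_gap m_le.
move/(proven_by_branchingP p_gt0 _ lo_min hi_max lt_lo_hi).
set k := Num.floor (beta%:~R / lo).
move/(_ k)/negP; apply; rewrite -/lo -/hi.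
have k_le : k%:~R * lo <= beta%:~R by rewrite -ler_pdivlMr // floor_le.
rewrite k_le /=.
have lt_k1 : beta%:~R < (k + 1)%:~R * lo by rewrite -ltr_pdivrMr // floorD1_gt.
have m_le_k : (m%:~R : R) <= k%:~R by rewrite ler_int floor_ge_int ler_pdivlMr.
have : m%:~R * (hi - lo) <= k%:~R * (hi - lo).
  by rewrite ler_wpM2r // subr_ge0 ltW.
move: lt_k1; rewrite intrD mulrDl mul1r mulrBr; lra.
Qed.

End Gaps.

(** * Maxima of sets of integers *)

Lemma ex_max_posint (P : int -> Prop) (b B : int) :
    0 < b -> P b -> (forall z, P z -> z <= B) ->
  exists F : int, [/\ 0 < F, P F & forall z, 0 < z -> P z -> z <= F].
Proof.
move=> b_gt0 Pb ubB.
pose Q (m : nat) := `[< 0 < m%:Z /\ P m%:Z >].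
have QE z : 0 < z -> P z -> Q `|z|%N.
  by move=> z_gt0 Pz; apply/asboolP; rewrite gtz0_abs.
have exQ : exists m, Q m by exists `|b|%N; exact: QE.
have ubQ m : Q m -> (m <= `|B|)%N.
  by move=> /asboolP[_ /ubB m_le]; rewrite -lez_nat (le_trans m_le) ?ler_norm.
case: (ex_maxnP exQ ubQ) => F /asboolP[F_gt0 PF] F_max.
exists F%:Z; split=> // z z_gt0 Pz.
by rewrite -(gtz0_abs z_gt0) lez_nat F_max // QE.
Qed.

(** * The ratios of p M + r and the bounds *)

Lemma comp_ratio_shift (R : realType) (n : nat) (p r : 'rV[int]_n) (M : int) i :
  0 < p 0 i -> comp_ratio R p (M *: p + r) i = M%:~R + comp_ratio R p r i.
Proof.
move=> pi_gt0; rewrite /comp_ratio !mxE intrD intrM mulrDl mulfK //.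
by rewrite intr_eq0 gt_eqF.
Qed.

Lemma comp_ratio_const_parallel (R : realType) (n : nat) (p r : 'rV[int]_n)
    (i0 : 'I_n) :
    (forall i, 0 < p 0 i) ->
    (forall i, comp_ratio R p r i = comp_ratio R p r i0) ->
  parallel p r.
Proof.
move=> p_gt0 q_const; exists (r 0 i0), (p 0 i0); split.
  by rewrite xpair_eqE (gt_eqF (p_gt0 i0)) andbF.
apply/rowP => i; rewrite !mxE; apply: (@intr_inj R); rewrite !intrM.
rewrite -(comp_ratioK R r p_gt0 i) -(comp_ratioK R r p_gt0 i0) q_const; ring.
Qed.

Theorem theorem6 (R : realType) (n : nat) (p r a : 'rV[int]_n.+1) (M : int)
    (p_gt0 : forall i, 0 < p 0 i)
    (pr_not_parallel : ~ parallel p r)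
    (q_sorted : forall i j : 'I_n.+1, (i <= j)%N -> comp_ratio R p r i <= comp_ratio R p r j)
    (fM1_ge0 : 0 <= frob_f p r M (1 : R))
    (a_def : a = M *: p + r)
    (a_gt0 : forall i, 0 < a 0 i) :
  exists Frob : int,
    [/\ is_branching_Frobenius R p a Frob,
        (frob_f p r M (1 : R))%:~R * (M%:~R + comp_ratio R p r ord_max) < Frob%:~R &
        Frob%:~R < (frob_f p r M (0 : R) + 1)%:~R * (M%:~R + comp_ratio R p r ord0)].
Proof.
have cE i : comp_ratio R p a i = M%:~R + comp_ratio R p r i.
  by rewrite a_def comp_ratio_shift.
have lo_gt0 : 0 < comp_ratio R p a ord0 by rewrite divr_gt0 ?ltr0z.
have lo_min i : comp_ratio R p a ord0 <= comp_ratio R p a i.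
  by rewrite !cE lerD2l q_sorted.
have hi_max i : comp_ratio R p a i <= comp_ratio R p a ord_max.
  by rewrite !cE lerD2l q_sorted // -ltnS ltn_ord.
have lt_lo_hi : comp_ratio R p a ord0 < comp_ratio R p a ord_max.
  rewrite lt_neqAle lo_min andbT; apply/eqP => lo_hi.
  apply: pr_not_parallel; apply: (@comp_ratio_const_parallel R _ _ _ ord0) => // i.
  by apply: (addrI M%:~R); rewrite -!cE; apply/le_anti; rewrite lo_min lo_hi hi_max.
have fE delta : frob_f p r M delta =
    Num.ceil ((comp_ratio R p a ord0 - delta) /
              (comp_ratio R p a ord_max - comp_ratio R p a ord0)) - 1.
  by rewrite /frob_f !cE; congr (Num.ceil (_ / _) - 1); ring.
rewrite -!cE; move: fM1_ge0; rewrite !fE subrK.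
set lo := comp_ratio R p a ord0 in lo_gt0 lo_min lt_lo_hi *.
set hi := comp_ratio R p a ord_max in hi_max lt_lo_hi *.
have d_gt0 : 0 < hi - lo by rewrite subr_gt0.
set k := Num.ceil _ - 1; set m := Num.ceil _ => k_ge0.
have gap_gt1 : k%:~R * (hi - lo) < lo - 1.
  by rewrite -ltr_pdivlMr // /k ceilB1_lt.
have no_gap : lo <= m%:~R * (hi - lo).
  by rewrite -ler_pdivrMr // /m subr0 ceil_ge.
have hi_gt0 := lt_trans lo_gt0 lt_lo_hi.
(* The gap after the [k]-th interval is longer than 1, so it contains the
   least integer beyond this interval. *)
pose b := Num.floor (k%:~R * hi) + 1.
have k_lt_b : k%:~R * hi < b%:~R by rewrite floorD1_gt.
have b_lt_k1 : b%:~R < (k + 1)%:~R * lo.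
  have : (Num.floor (k%:~R * hi))%:~R <= k%:~R * hi by exact: floor_le.
  move: gap_gt1; rewrite mulrBr /b !intrD mulrDl; lra.
have b_gt0 : 0 < b.
  by rewrite -(ltr0z R); apply: le_lt_trans k_lt_b; rewrite mulr_ge0 ?ler0z // ltW.
have proven_b := proven_in_gap p_gt0 lo_min hi_max lo_gt0 lt_lo_hi k_lt_b b_lt_k1.
have proven_lt beta : proven_by_branching R p a beta -> beta%:~R < m%:~R * lo.
  move=> proven; rewrite ltNge; apply/negP => m_le.
  exact: (not_proven_above p_gt0 lo_min hi_max lo_gt0 lt_lo_hi no_gap m_le proven).
have proven_le beta : proven_by_branching R p a beta ->
    beta <= Num.floor (m%:~R * lo).
  by move=> /proven_lt/ltW; rewrite floor_ge_int.
have [F [F_gt0 proven_F F_max]] := ex_max_posint b_gt0 proven_b proven_le.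
exists F; split=> //; last exact: proven_lt.
by apply: lt_le_trans k_lt_b _; rewrite ler_int F_max.
Qed.
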